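(* Let $(\Omega,\mathcal F)=(\Omega_1,\mathcal F_1)\times\cdots\times(\Omega_N,\mathcal F_N)$ be a product of measurable spaces and let $\mu$ be a probability measure on $(\Omega,\mathcal F)$. With the properties $AT(C)$, $P(C)$, $LS(C)$, $MLS(C)$ of $\mu$ defined in the context, the following implications hold for any $C>0$: $$AT(C)\Rightarrow P(C),\qquad LS(C)\Rightarrow AT(C)\Rightarrow MLS(C).$$
   Context: For $k\in\{1,\dots,N\}$, $\mu_k[f](x)=\mu[f\mid x_j,\ j\ne k]$ is the conditional expectation given all coordinates except the $k$-th. Set $\mathrm{Ent}_\mu(f)=\mu[f\log f]-\mu[f]\log\mu[f]$ for bounded measurable $f\ge0$ (with $0\log0=0$), $\mathrm{Var}_\mu(g)=\mu[g^2]-\mu[g]^2$, and let $\mathrm{Ent}_{\mu_k}(f)=\mu_k[f\log f]-\mu_k[f]\log\mu_k[f]$, $\mathrm{Var}_{\mu_k}(g)=\mu_k[g^2]-\mu_k[g]^2$, $\mathrm{Cov}_{\mu_k}(f,g)=\mu_k[fg]-\mu_k[f]\mu_k[g]$, which are functions on $\Omega$. When $f$ vanishes on a set of positive measure, $\mathrm{Cov}_{\mu_k}(f,\log f)$ is understood in $[0,+\infty]$, with $0\log 0=0$ and $0\cdot(-\infty)=0$. The measure $\mu$ satisfies: - $AT(C)$ (approximate tensorization) if $\mathrm{Ent}_\mu(f)\le C\sum_k\mu[\mathrm{Ent}_{\mu_k}(f)]$ for all bounded measurable $f:\Omega\to[0,\infty)$; - $P(C)$ (Poincaré inequality) if $\mathrm{Var}_\mu(g)\le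 C\sum_k\mu[\mathrm{Var}_{\mu_k}(g)]$ for all bounded measurable $g:\Omega\to\mathbb R$; - $LS(C)$ (log-Sobolev inequality) if $\mathrm{Ent}_\mu(f)\le C\sum_k\mu[\mathrm{Var}_{\mu_k}(\sqrt f)]$ for all bounded measurable $f:\Omega\to[0,\infty)$; - $MLS(C)$ (modified log-Sobolev inequality) if $\mathrm{Ent}_\mu(f)\le C\sum_k\mu[\mathrm{Cov}_{\mu_k}(f,\log f)]$ for all bounded measurable $f:\Omega\to[0,\infty)$. *)

(* Defs.v *)
From HB Require Import structures.
From mathcomp Require Import all_boot all_order all_algebra.
From mathcomp Require Import all_classical all_reals all_analysis.
From mathcomp Require Import measurable_realfun.

Set Implicit Arguments.
Unset Strict Implicit.
Unset Printing Implicit Defensive.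

Import Order.TTheory GRing.Theory Num.Theory.
Import numFieldNormedType.Exports.

Local Open Scope classical_set_scope.
Local Open Scope ring_scope.
Local Open Scope ereal_scope.

Definition cylinders (N : nat) (d : 'I_N -> measure_display)
    (Omega : forall i : 'I_N, measurableType (d i)) (J : set 'I_N) :
    set (set (forall i : 'I_N, Omega i)) :=
  \bigcup_(i in J)
    preimage_set_system setT (fun x : forall j : 'I_N, Omega j => x i)
      measurable.
Arguments cylinders {N d} Omega J.

Notation product_space Omega := (g_sigma_algebraType (cylinders Omega setT)).

Section conditional_expectation.
Context (d : measure_display) (T : measurableType d) (R : realType).
Variables (P : probability T R) (G : set (set T)).

(* g is a version of E[h | sigma(G)], for G a family of measurable sets and
   h measurable and bounded above (possibly taking the value -oo): the common
   value of the two integrals is then in [-oo, +oo[, and g is unique up to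
   P-a.e. equality. *)
Definition is_condexp (h g : T -> \bar R) : Prop :=
  measurable_fun [set: g_sigma_algebraType G]
    (g : g_sigma_algebraType G -> \bar R) /\
  forall A : set T, <<s G >> A ->
    \int[P]_(x in A) g x = \int[P]_(x in A) h x.

(* An arbitrary version; the default value is irrelevant for h measurable and
   bounded above, in which case a version exists. *)
Definition condexp (h : T -> \bar R) : T -> \bar R :=
  xget (cst 0) [set g | is_condexp h g].

End conditional_expectation.

Section functionals.
Context (R : realType) (N : nat) (d : 'I_N -> measure_display)
  (Omega : forall i : 'I_N, measurableType (d i)).
Variable mu : probability (product_space Omega) R.

Implicit Types (k : 'I_N) (f g : product_space Omega -> R)
  (u v : product_space Omega -> \bar R).

(* In the definitions below 0 log 0 = 0 because ln 0 = 0 in R, and because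
   lne 0 = -oo and 0 * -oo = 0 in \bar R. *)
Definition Ent f : \bar R :=
  'E_mu[fun x => (f x * ln (f x))%R] - 'E_mu[f] * lne 'E_mu[f].

Definition Var g : \bar R :=
  'E_mu[fun x => (g x ^+ 2)%R] - 'E_mu[g] ^+ 2.

Definition mu_ k u : product_space Omega -> \bar R :=
  condexp mu (cylinders Omega (~` [set k])) u.

Definition Ent_ k f : product_space Omega -> \bar R := fun x =>
  mu_ k (fun y => (f y * ln (f y))%:E) x
    - mu_ k (EFin \o f) x * lne (mu_ k (EFin \o f) x).

Definition Var_ k g : product_space Omega -> \bar R := fun x =>
  mu_ k (fun y => (g y ^+ 2)%:E) x - mu_ k (EFin \o g) x ^+ 2.

Definition Cov_ k u v : product_space Omega -> \bar R := fun x =>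
  mu_ k (u \* v) x - mu_ k u x * mu_ k v x.

Definition AT (C : R) : Prop :=
  forall f, measurable_fun setT f -> bounded_fun f ->
    (forall x, (0 <= f x)%R) ->
    Ent f <= C%:E * \sum_(k < N) \int[mu]_x Ent_ k f x.

Definition Poincare (C : R) : Prop :=
  forall g, measurable_fun setT g -> bounded_fun g ->
    Var g <= C%:E * \sum_(k < N) \int[mu]_x Var_ k g x.

Definition LS (C : R) : Prop :=
  forall f, measurable_fun setT f -> bounded_fun f ->
    (forall x, (0 <= f x)%R) ->
    Ent f <= C%:E * \sum_(k < N) \int[mu]_x Var_ k (Num.sqrt \o f) x.

(* log f is taken in \bar R, with value -oo where f vanishes. *)
Definition MLS (C : R) : Prop :=
  forall f, measurable_fun setT f -> bounded_fun f ->
    (forall x, (0 <= f x)%R) ->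
    Ent f <= C%:E * \sum_(k < N) \int[mu]_x
      Cov_ k (EFin \o f) (fun y => lne (f y)%:E) x.

End functionals.

(* Main.v *)
Require Import Defs.
From HB Require Import structures.
From mathcomp Require Import all_boot all_order all_algebra.
From mathcomp Require Import all_classical all_reals all_analysis.
From mathcomp Require Import measurable_realfun ring lra.

(* All four functionals are integrals of conditional expectations given the
   sigma-algebra G_k generated by the coordinates other than k. Write phi for
   x ln x and E_k f for the conditional expectation; then the integral of
   Ent_k f is E[phi f] - E[phi (E_k f)] and that of Var_k g is
   E[g^2] - E[(E_k g)^2].

   AT => P: apply AT to 1 + t g and let t tend to 0; to second order in t,
   entropies become t^2 / 2 times variances.
   LS => AT: E[Var_k (sqrt f)] <= E[Ent_k f], from ln x <= x - 1 and a completed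
   square.
   AT => MLS: Ent_k f <= Cov_k (f, ln f) follows from E_k [ln f] <= ln (E_k f),
   conditional Jensen.

   Existence of conditional expectations comes from Radon-Nikodym for bounded
   functions, and by summing increments of truncations for functions that are
   only bounded above, such as ln f. *)

Set Implicit Arguments.
Unset Strict Implicit.
Unset Printing Implicit Defensive.

Import Order.TTheory GRing.Theory Num.Theory.
Import numFieldNormedType.Exports.
Import HBNNSimple.

Local Open Scope classical_set_scope.
Local Open Scope ring_scope.

(** * Bounded measurable functions *)

(** This class is stable under the ring operations and integrable for every probability, so
    integrals of its members can be handled as real numbers. *)
Definition bounded_measurable d (T : measurableType d) (R : realType)
    (u : T -> R) :=
  measurable_fun setT u /\ exists M, forall x, `|u x| <= M.

Section bounded_measurable_theory.
Context d (T : measurableType d) (R : realType).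
Implicit Types u v : T -> R.

Lemma bm_cst (c : R) : bounded_measurable (cst c : T -> R).
Proof. by split; [exact: measurable_cst|exists `|c|]. Qed.

Lemma bmD u v : bounded_measurable u -> bounded_measurable v ->
  bounded_measurable (fun x => u x + v x).
Proof.
move=> [mu [M uM]] [mv [K vK]]; split; first exact: measurable_funD.
by exists (M + K) => x; rewrite (le_trans (ler_normD _ _))// lerD.
Qed.

Lemma bmM u v : bounded_measurable u -> bounded_measurable v ->
  bounded_measurable (fun x => u x * v x).
Proof.
move=> [mu [M uM]] [mv [K vK]]; split; first exact: measurable_funM.
by exists (M * K) => x; rewrite normrM ler_pM.
Qed.

Lemma bmZ (c : R) u : bounded_measurable u ->
  bounded_measurable (fun x => c * u x).
Proof. by move=> ?; apply: (@bmM (cst c)) => //; exact: bm_cst. Qed.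

Lemma bmN u : bounded_measurable u -> bounded_measurable (fun x => - u x).
Proof.
move=> [mu [M uM]]; split; first exact: measurable_funN.
by exists M => x; rewrite normrN.
Qed.

Lemma bmB u v : bounded_measurable u -> bounded_measurable v ->
  bounded_measurable (fun x => u x - v x).
Proof. by move=> bu bv; apply: bmD => //; exact: bmN. Qed.

Lemma bmX u : bounded_measurable u -> bounded_measurable (fun x => u x ^+ 2).
Proof. by move=> bu; apply: bmM. Qed.

Lemma bm_indic (A : set T) : measurable A ->
  bounded_measurable (\1_A : T -> R).
Proof.
move=> mA; split; first exact: measurable_indic.
by exists 1 => x; rewrite indicE; case: (x \in A); rewrite ?normr1 ?normr0.
Qed.

Context (P : probability T R).
Local Notation "<< u >>" := (Rintegral P setT u).

Lemma bm_integrable u (A : set T) : measurable A ->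
  bounded_measurable u -> P.-integrable A (EFin \o u).
Proof.
move=> mA [mu [M uM]]; apply: (@integrableS _ _ _ _ setT) => //.
apply: measurable_bounded_integrable => //.
  by rewrite -ge0_fin_numE// fin_num_measure.
exists M; split; first by rewrite num_real.
by move=> r Mr x _; apply: le_trans (uM x) _; exact: ltW.
Qed.

Lemma bm_fin_num u (A : set T) : measurable A -> bounded_measurable u ->
  (\int[P]_(x in A) (u x)%:E)%E \is a fin_num.
Proof. by move=> mA bu; apply: integrable_fin_num => //; exact: bm_integrable. Qed.

Lemma EFin_Rintegral u : bounded_measurable u ->
  (\int[P]_x (u x)%:E = << u >>%:E)%E.
Proof. by move=> bu; rewrite fineK// bm_fin_num. Qed.

Lemma mean_cst (c : R) : << cst c >> = c.
Proof. by rewrite Rintegral_cst//= probability_setT mulr1. Qed.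

Lemma meanD u v : bounded_measurable u -> bounded_measurable v ->
  << fun x => u x + v x >> = << u >> + << v >>.
Proof. by move=> bu bv; rewrite RintegralD//; exact: bm_integrable. Qed.

Lemma meanB u v : bounded_measurable u -> bounded_measurable v ->
  << fun x => u x - v x >> = << u >> - << v >>.
Proof. by move=> bu bv; rewrite RintegralB//; exact: bm_integrable. Qed.

Lemma meanZ (c : R) u : bounded_measurable u ->
  << fun x => c * u x >> = c * << u >>.
Proof. by move=> bu; rewrite RintegralZl//; exact: bm_integrable. Qed.

Lemma le_mean u v : bounded_measurable u -> bounded_measurable v ->
  (forall x, u x <= v x) -> << u >> <= << v >>.
Proof. by move=> bu bv uv; rewrite le_Rintegral//; exact: bm_integrable. Qed.

Lemma mean_itv u a b : bounded_measurable u -> (forall x, a <= u x <= b) ->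
  a <= << u >> <= b.
Proof.
move=> bu uab; rewrite -{1}(mean_cst a) -{1}(mean_cst b).
by apply/andP; split; apply: le_mean => //; try exact: bm_cst;
  move=> x; have /andP[] := uab x.
Qed.

(* No integrability is required, since [+oo - +oo = -oo]. *)
Lemma ae_le_integral (A : set T) (f g : T -> \bar R) : measurable A ->
  measurable_fun A f -> measurable_fun A g ->
  {ae P, forall x, A x -> (f x <= g x)%E} ->
  (\int[P]_(x in A) f x <= \int[P]_(x in A) g x)%E.
Proof.
move=> mA mf mg fg.
rewrite integralE [leRHS]integralE leeB//.
- apply: ae_ge0_le_integral => //; [exact: measurable_funepos..|].
  by apply: filterS fg => x /[apply] fg; rewrite !funeposE le_max2.
- apply: ae_ge0_le_integral => //; [exact: measurable_funeneg..|].
  by apply: filterS fg => x /[apply] fg; rewrite !funenegE le_max2// leeN2.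
Qed.

Lemma integral_mean_indic u (A : set T) : measurable A ->
  bounded_measurable u ->
  (\int[P]_(x in A) (u x)%:E = << fun x => u x * \1_A x >>%:E)%E.
Proof.
move=> mA bu; rewrite -EFin_Rintegral; last by apply: bmM => //; exact: bm_indic.
rewrite integral_mkcond; apply: eq_integral => x _.
by rewrite indicE patchE; case: ifP; rewrite ?mulr1 ?mulr0.
Qed.

End bounded_measurable_theory.

(** * Conditional expectation of bounded functions *)

Section sub_sigma_algebra.
Context d (T : measurableType d) (R : realType) (P : probability T R).
Variable G : set (set T).
Hypothesis Gm : G `<=` measurable.
Local Notation S := (g_sigma_algebraType G).
Local Notation "<< u >>" := (Rintegral P setT u).

Lemma sub_measurable (A : set T) : <<s G >> A -> measurable A.
Proof. by apply: smallest_sub => //; exact: sigma_algebra_measurable. Qed.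

Lemma measurable_sub_id : measurable_fun setT (id : T -> S).
Proof. by move=> _ A mA; rewrite setTI; exact: sub_measurable. Qed.

Lemma measurable_sub d' (U : measurableType d') (u : S -> U) :
  measurable_fun setT u -> measurable_fun setT (u : T -> U).
Proof.
by move=> mu; apply: (measurableT_comp mu); exact: measurable_sub_id.
Qed.

Lemma bm_sub (u : S -> R) :
  bounded_measurable u -> bounded_measurable (u : T -> R).
Proof. by move=> [mu bu]; split => //; exact: measurable_sub. Qed.

Let incl : T -> S := id.
HB.instance Definition _ := isMeasurableFun.Build _ _ _ _ incl measurable_sub_id.
(** The restriction of [P] to the sigma-algebra generated by [G], encoded as the law of the identity
    map into the coarser space. *)
Let Q := distribution P (incl : {mfun T >-> S}).

Let integral_sub (A : set S) (g : S -> \bar R) : measurable A ->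
  measurable_fun setT g ->
  (\int[Q]_(x in A) g x = \int[P]_(x in A) (g : T -> \bar R) x)%E.
Proof.
move=> mA mg; rewrite integralE [RHS]integralE; congr (_ - _)%E.
- by rewrite ge0_integral_pushforward//; exact/measurable_funepos/measurable_funTS.
- by rewrite ge0_integral_pushforward//; exact/measurable_funeneg/measurable_funTS.
Qed.

(** The charge sending [A] to the integral of [h] over [A], restricted to the coarser sigma-algebra,
    is absolutely continuous with respect to [Q]; its density is the conditional expectation. *)
Lemma condexp_integrable_ex (h : T -> \bar R) : P.-integrable setT h ->
  exists e : S -> R, [/\ measurable_fun setT e, P.-integrable setT (EFin \o e) &
    is_condexp P G h (EFin \o e)].
Proof.
move=> inth.
have [nu nuE] : exists nu : {charge set S -> \bar R},
    forall A : set S, nu A = (\int[P]_(x in A) h x)%E.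
  unshelve eexists (pushforward (induced_charge inth) incl).
    exact: measurable_sub_id.
  by [].
have nuQ : nu `<< Q.
  apply/null_content_dominatesP => A mA QA; rewrite nuE.
  apply: null_set_integral => //; first exact: sub_measurable.
  exact: measurable_funTS (measurable_int _ inth).
have gfin := Radon_Nikodym_fin_num _ nuQ.
have intg := Radon_Nikodym_integrable nuQ.
have gE A := @Radon_Nikodym_integral _ _ _ nu Q A nuQ.
set g := Radon_Nikodym nu Q in gfin intg gE.
have mg := measurable_int _ intg.
(* The density is finite at every point, so [fine] changes no value. *)
have gfine : EFin \o (fine \o g) = g by apply/funext => x /=; rewrite fineK.
exists (fine \o g); rewrite gfine; split.
- exact: measurableT_comp.
- apply/integrableP; split; first exact: measurable_sub.
  rewrite -(@integral_sub setT (abse \o g))//; last exact: measurableT_comp.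
  by case/integrableP : intg.
- split=> // A GA; rewrite -nuE gE//.
  by rewrite integral_sub.
Qed.


(** The sets where [v] exceeds [u] by at least [1 / (n + 1)] belong to the coarser sigma-algebra;
    comparing integrals over each of them shows that it is null. *)
Lemma le_condexp (u : S -> R) (v : S -> \bar R) :
  measurable_fun setT u -> P.-integrable setT (EFin \o u) ->
  measurable_fun setT v ->
  (forall A, <<s G >> A ->
    (\int[P]_(x in A) v x <= \int[P]_(x in A) (u x)%:E)%E) ->
  {ae P, forall x, (v x <= (u x)%:E)%E}.
Proof.
move=> mu intu mv vu.
pose A n : set S := [set x | ((u x + n.+1%:R^-1)%:E <= v x)%E].
have mA n : measurable (A n : set S).
  rewrite -[A n]setTI; apply: measurable_lee => //.
  by apply/measurable_EFinP; exact: measurable_funD.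
have A0 n : {ae P, forall x, (v x < (u x + n.+1%:R^-1)%:E)%E}.
  have mAT := sub_measurable (mA n).
  have intA : P.-integrable (A n) (EFin \o u) by exact: integrableS intu.
  have intc : P.-integrable (A n) (EFin \o cst (n.+1%:R^-1 : R)).
    by apply: bm_integrable => //; exact: bm_cst.
  exists (A n); split => //; last first.
    by move=> x /= /negP; rewrite -leNgt.
  have : (\int[P]_(x in A n) ((u x)%:E + (n.+1%:R^-1)%:E) <=
      \int[P]_(x in A n) (u x)%:E)%E.
    apply: le_trans (vu _ (mA n)).
    apply: ae_le_integral => //.
      by apply: emeasurable_funD => //; exact: measurable_int intA.
      by apply: measurable_funTS; exact: measurable_sub.
    by apply: aeW => x Ax; rewrite -EFinD.
  (* The integral of [u] over [A n] is finite and cancels, leaving [P (A n) / (n + 1) <= 0]. *)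
  rewrite integralD// integral_cst// -[leRHS]adde0 leeD2lE; last first.
    exact: integrable_fin_num intA.
  rewrite pmule_rle0 ?lte_fin ?invr_gt0// => PA.
  by apply/eqP; rewrite eq_le PA measure_ge0.
have := ae_foralln A0; apply: filterS => x vx.
apply/lee_addgt0Pr => e e0; rewrite -EFinD.
have [n ne] := ltr_add_invr e0.
rewrite (le_trans (ltW (vx n)))// lee_fin lerD2l.
by move: ne; rewrite add0r => /ltW.
Qed.

Lemma condexp_uniq (u : S -> R) (v : S -> \bar R) :
  measurable_fun setT u -> P.-integrable setT (EFin \o u) ->
  is_condexp P G (EFin \o u) v -> {ae P, forall x, v x = (u x)%:E}.
Proof.
move=> mu intu [mv vu].
have mEu : measurable_fun setT (EFin \o u) by exact/measurable_EFinP.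
have : ae_eq Q setT (EFin \o u) v.
  apply: integral_ae_eq => //.
    apply/integrableP; split=> //.
    rewrite (@integral_sub setT (abse \o (EFin \o u)))//.
      by case/integrableP : intu.
    exact: measurableT_comp.
  by move=> E _ mE; rewrite !integral_sub// vu.
case=> N [mN QN sN]; exists N; split => //; first exact: sub_measurable.
by apply: subset_trans sN => x /= vxN /(_ I)/esym.
Qed.


(** Clamping a version to [[a, b]] changes it only on a null set. With bounds at every point,
    pointwise inequalities apply to versions directly. *)
Lemma condexp_bounded_ex (f : T -> R) (a b : R) : bounded_measurable f ->
  (forall x, a <= f x <= b) ->
  exists e : S -> R, [/\ bounded_measurable e, forall x, a <= e x <= b &
    is_condexp P G (EFin \o f) (EFin \o e)].
Proof.
move=> bf fab.
have [e0 [me0 ie0 [_ e0E]]] := condexp_integrable_ex (bm_integrable P measurableT bf).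
have ab : a <= b by have /andP[] := fab point; exact: le_trans.
pose e (x : S) := Num.min b (Num.max a (e0 x)).
have eab x : a <= e x <= b by rewrite /e le_min ab le_max lexx /= ge_min lexx.
have me : measurable_fun setT e.
  by apply: measurable_minr => //; exact: measurable_maxr.
have le_set (c : R) (A : set T) : <<s G >> A -> P.-integrable A (EFin \o cst c).
  by move=> /sub_measurable mA; apply: bm_integrable => //; exact: bm_cst.
have ae0 : {ae P, forall x, ((cst a x)%:E <= (e0 x)%:E)%E}.
  apply: (@le_condexp e0 (EFin \o cst a)) => // [|A GA].
    exact: (@measurable_cst _ _ _ _ _ a%:E).
  have mA := sub_measurable GA.
  rewrite e0E//; apply: le_integral => //; first exact: le_set.
    exact: bm_integrable.
  by move=> x _; rewrite lee_fin; have /andP[] := fab x.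
have e0b : {ae P, forall x, ((e0 x)%:E <= (cst b x)%:E)%E}.
  apply: (@le_condexp (cst b) (EFin \o e0)) => //.
    by apply: bm_integrable; [exact: measurableT|exact: bm_cst].
    exact/measurable_EFinP.
  move=> A GA; have mA := sub_measurable GA.
  rewrite e0E//; apply: le_integral => //; [exact: bm_integrable|exact: le_set|].
  by move=> x _; rewrite lee_fin; have /andP[] := fab x.
exists e; split=> //.
  split=> //; exists (Num.max `|a| `|b|) => x; have /andP[ax xb] := eab x.
  rewrite le_max; case: (leP 0 (e x)) => ex.
    by rewrite orbC ger0_norm// (le_trans xb)// ler_norm.
  by rewrite ltr0_norm// -(normrN a) (le_trans _ (ler_norm _))// lerN2.
split; first exact/measurable_EFinP.
move=> A GA; rewrite -e0E//; have mA := sub_measurable GA.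
apply: ae_eq_integral => //.
- by apply: measurable_funTS; apply/measurable_EFinP; exact: measurable_sub.
- by apply: measurable_funTS; apply/measurable_EFinP; exact: measurable_sub.
have F := ae_filter_ringOfSetsType P.
apply: filterS (filterI ae0 e0b) => x []; rewrite !lee_fin/= => ax xb _.
by congr (_%:E); rewrite /e (max_r ax) (min_r xb).
Qed.

(** The defect [f - e] is orthogonal to indicators of sets of the coarser sigma-algebra. This
    extends to simple functions by linearity, to nonnegative bounded functions by dominated
    convergence, and to bounded functions by a shift. *)
Lemma mean_condexpM (f : T -> R) (e u : S -> R) : bounded_measurable f ->
  bounded_measurable e -> bounded_measurable u ->
  is_condexp P G (EFin \o f) (EFin \o e) ->
  << fun x => f x * u x >> = << fun x => e x * u x >>.
Proof.
move=> bf be bu [_ eE].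
pose D (x : T) := f x - e x.
have beT := bm_sub be.
have bD : bounded_measurable D by exact: bmB.
have D_indic (A : set S) : measurable A -> << fun x => D x * \1_A x >> = 0.
  move=> mA; have mAT := sub_measurable mA.
  have bA := bm_indic R mAT.
  rewrite /D; under eq_Rintegral do rewrite mulrBl.
  rewrite meanB; [|exact: bmM..].
  apply/eqP; rewrite subr_eq0; apply/eqP; apply: EFin_inj.
  by rewrite -!integral_mean_indic//; exact/esym/eE.
pose Z (s : T -> R) := bounded_measurable s /\ << fun x => D x * s x >> = 0.
have ZD s t : Z s -> Z t -> Z (fun x => s x + t x).
  move=> [bs s0] [bt t0]; split; first exact: bmD.
  under eq_Rintegral do rewrite mulrDr.
  by rewrite meanD ?s0 ?t0 ?addr0//; exact: bmM.
have ZZ c s : Z s -> Z (fun x => c * s x).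
  move=> [bs s0]; split; first exact: bmZ.
  under eq_Rintegral do rewrite mulrCA.
  by rewrite meanZ ?s0 ?mulr0//; exact: bmM.
have Zindic (A : set S) : measurable A -> Z \1_A.
  move=> mA; split; last exact: D_indic.
  by apply: bm_indic; exact: sub_measurable.
have Zsfun (s : {nnsfun S >-> R}) : Z (s : S -> R).
  rewrite (_ : (s : S -> R) = \sum_(y <- finmap.enum_fset (fset_set (range s)))
      (fun x : S => y * \1_(s @^-1` [set y]) x)); last first.
    by apply/funext => x; rewrite fct_sumE fimfunE fsbig_finite.
  elim/big_ind : _ => //.
    by split; [exact: bm_cst|under eq_Rintegral do rewrite mulr0; exact: mean_cst].
  by move=> i _; apply: ZZ; apply: Zindic; exact: measurable_funPTI.
have Zpos (v : S -> R) : bounded_measurable v -> (forall x, 0 <= v x) -> Z v.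
  move=> bv v0; have bvT := bm_sub bv; split => //.
  have mEv : measurable_fun setT (EFin \o v) by apply/measurable_EFinP; case: bv.
  pose s n := nnsfun_approx measurableT mEv n.
  have [[_ [K DK]] [_ [M vM]]] := (bD, bv).
  have sv n x : s n x <= v x.
    by rewrite -lee_fin /s nnsfun_approxE; apply: le_approx => //= y _; rewrite lee_fin.
  have [] := @dominated_convergence _ _ _ P setT measurableT
    (fun n x => (D x * s n x)%:E) (fun x => (D x * v x)%:E) (cst (K * M)%:E).
  - by move=> n; apply/measurable_EFinP; case: (bmM bD (Zsfun (s n)).1).
  - by apply/measurable_EFinP; case: (bmM bD bvT).
  - apply: aeW => x _; under eq_fun do rewrite EFinM.
    rewrite EFinM; apply: cvgeZl => //.
    by apply: cvg_nnsfun_approx => // y _; rewrite lee_fin.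
  - by apply: bm_integrable => //; exact: bm_cst.
  - apply: aeW => x n _; rewrite lee_fin normrM ler_pM//.
    by rewrite (le_trans _ (vM x))// !ger0_norm.
  - move=> _ _; set I := (I in I @ \oo --> _) => I_cvg.
    have I0 : I = cst 0%E.
      apply/funext => n; rewrite /I/= EFin_Rintegral ?(Zsfun (s n)).2//.
      exact: bmM (Zsfun (s n)).1.
    move: I_cvg; rewrite I0 => /(cvg_lim (@ereal_hausdorff R)).
    by rewrite lim_cst /Rintegral//; move=> <-.
have [_ [M uM]] := bu.
have [_ ] : Z u.
  (* Adding the bound [M] makes [u] nonnegative; the constant is taken back as a multiple of the
     indicator of the whole space. *)
  rewrite (_ : (u : T -> R) = fun x => (u x + M) + (- M) * \1_setT x); last first.
    by apply/funext => x; rewrite indicT mulr1 addrK.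
  apply: ZD; last exact/ZZ/Zindic.
  apply: Zpos; first by apply: bmD => //; exact: bm_cst.
  by move=> x; rewrite -lerBlDr sub0r; have := uM x; rewrite ler_norml => /andP[].
rewrite /D; under eq_Rintegral do rewrite mulrBl.
have buT := bm_sub bu.
by rewrite meanB; [move/eqP; rewrite subr_eq0 => /eqP|exact: bmM..].
Qed.

End sub_sigma_algebra.

(** * Conditional expectation of functions bounded above *)

Section condexp_bounded_above.
Context d (T : measurableType d) (R : realType) (P : probability T R).
Variable G : set (set T).
Hypothesis Gm : G `<=` measurable.
Local Notation S := (g_sigma_algebraType G).
Local Open Scope ereal_scope.

(** Linearity if [g] has finite integral. Otherwise both sides are [-oo]: the positive part of
    [M - g] is at most [|M|], while its negative part has infinite integral. *)
Lemma integral_cstB (A : set T) (M : R) (g : T -> \bar R) : measurable A ->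
  measurable_fun A g -> (forall x, 0 <= g x) ->
  \int[P]_(x in A) (M%:E - g x) = \int[P]_(x in A) M%:E - \int[P]_(x in A) g x.
Proof.
move=> mA mg g0.
have icst (c : R) : P.-integrable A (cst c%:E).
  by apply: (@bm_integrable _ _ _ P (cst c)) => //; exact: bm_cst.
have [gfin|] := ltP (\int[P]_(x in A) g x) +oo.
  rewrite integralB//; first exact: icst.
  apply/integrableP; split => //.
  by rewrite (eq_integral g)// => x _; rewrite gee0_abs.
rewrite leye_eq => /eqP goo; rewrite goo.
pose w x := M%:E - g x.
have mw : measurable_fun A w by exact: emeasurable_funB.
have -> : \int[P]_(x in A) M%:E - +oo = -oo.
  have := integrable_fin_num mA (icst M).
  by case: (\int[P]_(x in A) cst M%:E x).
have M0 (x : T) : A x -> 0 <= cst `|M|%:E x by move=> _; rewrite lee_fin.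
have Mfin : \int[P]_(x in A) (cst `|M|%:E x) < +oo.
  rewrite -ge0_fin_numE; first exact: integrable_fin_num (icst `|M|%R).
  exact: integral_ge0.
have pos : \int[P]_(x in A) w^\+ x < +oo.
  have : \int[P]_(x in A) w^\+ x <= \int[P]_(x in A) (cst `|M|%:E x).
    apply: ge0_le_integral => //; first exact: measurable_funepos.
    move=> x Ax; rewrite funeposE ge_max lee_fin normr_ge0 andbT.
    apply: (@le_trans _ _ M%:E); last by rewrite lee_fin ler_norm.
    by apply: geeDl; rewrite leeNl oppe0.
  by move=> /le_lt_trans; exact.
(* Since [g <= w^\- + |M|], a finite integral of [w^\-] would make that of [g] finite. *)
have neg : \int[P]_(x in A) w^\- x = +oo.
  apply/eqP; rewrite -leye_eq leNgt; apply/negP => negfin.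
  have : \int[P]_(x in A) g x <= \int[P]_(x in A) (w^\- x + cst `|M|%:E x).
    apply: ge0_le_integral => //.
      by apply: emeasurable_funD => //; exact: measurable_funeneg.
    move=> x Ax; rewrite funenegE /w/=; case: (g x) (g0 x) => [r| |]//= r0.
      rewrite -EFin_max -EFinD lee_fin -lerBlDr le_max; apply/orP; left.
      by rewrite opprB lerD2l lerN2 ler_norm.
  rewrite goo ge0_integralD//; last exact: measurable_funeneg.
  by apply/negP; rewrite -ltNge; exact: lte_add_pinfty.
rewrite -[LHS]/(\int[P]_(x in A) w x) [LHS]integralE neg.
by move: pos; case: (\int[P]_(x in A) _).
Qed.

Lemma cvg_mine_natr (w : \bar R) : 0 <= w ->
  mine w n%:R%:E @[n --> \oo] --> w.
Proof.
case: w => [r r0| _|//].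
  apply: cvg_near_cst; near=> n.
  by apply/min_idPl; rewrite lee_fin; near: n; exact: nbhs_infty_ger.
under eq_fun do rewrite min_r ?leey//.
exact/cvgenyP.
Unshelve. all: by end_near. Qed.

(** The increments of the truncations of [w] at the integers lie in [[0, 1]], so they have versions
    that are nonnegative at every point; the series of these versions is the candidate. *)
Lemma condexp_ge0_ex (w : T -> \bar R) : measurable_fun setT w ->
  (forall x, 0 <= w x) ->
  exists g : S -> \bar R, (forall x, 0 <= g x) /\ is_condexp P G w g.
Proof.
move=> mw w0.
pose m n x : R := fine (mine (w x) n%:R%:E).
have mE n x : (m n x)%:E = mine (w x) n%:R%:E.
  rewrite /m fineK// fin_numElt; apply/andP; split.
    by apply: (@lt_le_trans _ _ 0); rewrite ?ltNy0// le_min w0 lee_fin ler0n.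
  by apply: (@le_lt_trans _ _ n%:R%:E); rewrite ?ltry// ge_min lexx orbT.
have mm n : measurable_fun setT (m n).
  apply/measurable_EFinP; rewrite (_ : _ \o _ = fun x => mine (w x) n%:R%:E).
    by apply: measurable_mine.
  by apply/funext => x; exact: mE.
have mS n x : (0 <= m n.+1 x - m n x <= 1)%R.
  rewrite subr_ge0 lerBlDr -!lee_fin EFinD !mE; apply/andP; split.
    by rewrite le_min2// lee_fin ler_nat.
  case: (w x) (w0 x) => [r| |]//= r0.
    rewrite -!EFin_min -EFinD lee_fin -natr1; case: (leP r n%:R) => rn.
      by rewrite ge_min; apply/orP; left; rewrite lerDr.
    by rewrite addrC ge_min lexx orbT.
  by rewrite !min_r ?leey// -EFinD lee_fin -natr1 addrC.
have bmS n : bounded_measurable (fun x => m n.+1 x - m n x)%R.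
  split; first exact: measurable_funB.
  by exists 1%R => x; have /andP[? ?] := mS n x; rewrite ger0_norm.
have sumE x : \sum_(n <oo) (m n.+1 x - m n x)%:E = w x.
  have -> : (fun n => \sum_(0 <= i < n) (m i.+1 x - m i x)%:E) =
      (fun n => mine (w x) n%:R%:E).
    apply/funext => n; rewrite -mE sumEFin telescope_sumr//.
    by rewrite [m 0%N x]/m min_r ?w0// subr0.
  by apply/cvg_lim => //; exact: cvg_mine_natr.
have [e eP] := choice (fun n => condexp_bounded_ex P Gm (bmS n) (mS n)).
have me n : measurable_fun setT (EFin \o e n).
  by apply/measurable_EFinP; case: (eP n) => -[].
have e0 n x : 0 <= (e n x)%:E.
  by rewrite lee_fin; case: (eP n) => _ /(_ x)/andP[].
exists (fun x => \sum_(n <oo) (e n x)%:E); split.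
  by move=> x; exact: nneseries_ge0.
split.
  apply: (@ge0_emeasurable_sum _ _ _ setT (fun n x => (e n x)%:E) xpredT).
    by move=> n x _ _; exact: e0.
  by move=> n _; exact: me.

move=> A GA; have mA := sub_measurable Gm GA.
have mS1 n : measurable_fun A (fun x => (m n.+1 x - m n x)%:E).
  by apply: measurable_funTS; apply/measurable_EFinP; case: (bmS n).
have S0 n x : A x -> 0 <= (m n.+1 x - m n x)%:E.
  by move=> _; rewrite lee_fin; have /andP[] := mS n x.
(* Monotone convergence exchanges sum and integral on both sides, which reduces the claim to single
   increments. *)
under [RHS]eq_integral do rewrite -sumE.
rewrite (integral_nneseries _ mA mS1 S0) integral_nneseries//.
  by apply: eq_eseriesr => n _; case: (eP n) => _ _ [_ ->].
by move=> n; apply: measurable_funTS; exact (measurable_sub Gm (me n)).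
Qed.

Lemma is_condexp_condexp (h g : T -> \bar R) :
  is_condexp P G h g -> is_condexp P G h (condexp P G h).
Proof. by move=> hg; rewrite /condexp; case: xgetP => [y _ //|/(_ g)]. Qed.

(** If [g] is a version for the nonnegative function [M - h], then [M - g] is one for [h]; hence
    [condexp] does not fall back on its default value. *)
Lemma condexpP (h : T -> \bar R) (M : R) : measurable_fun setT h ->
  (forall x, h x <= M%:E) -> is_condexp P G h (condexp P G h).
Proof.
move=> mh hM.
pose w x := M%:E - h x.
have mw : measurable_fun setT w by exact: emeasurable_funB.
have w0 x : 0 <= w x.
  rewrite /w; case: (h x) (hM x) => [r| |]//=; last by rewrite addey.
  by rewrite lee_fin => rM; rewrite -EFinB lee_fin subr_ge0.
have hE x : h x = M%:E - w x.
  by rewrite /w; case: (h x) (hM x) => [r| |]//= _; rewrite -!EFinB subKr.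
have [g [g0 [mg gw]]] := condexp_ge0_ex mw w0.
apply: (@is_condexp_condexp _ (fun x => M%:E - g x)); split; first exact: emeasurable_funB.
move=> A GA; have mA := sub_measurable Gm GA.
rewrite integral_cstB//; last first.
  exact: measurable_funTS (measurable_sub Gm mg).
rewrite gw// -integral_cstB//; last exact: measurable_funTS.
by apply: eq_integral => x _; rewrite hE.
Qed.

End condexp_bounded_above.

(** * The function x ln x *)

Section logarithm.
Context (R : realType).
Implicit Types x y t : R.

(** This is [ln (1 + z) <= z] with [z = x / y - 1]. The Taylor bound, conditional Jensen and the
    square-root inequality all rest on it. *)
Lemma ln_tangent x y : 0 < x -> 0 < y -> ln x <= ln y + (x / y - 1).
Proof.
move=> x0 y0; rewrite -lerBlDl -ln_div ?posrE//.
have -> : x / y = 1 + (x / y - 1) by rewrite addrC subrK.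
rewrite [in leRHS]addrAC subrr add0r; apply: le_ln1Dx.
by rewrite ltrBrDr addrC subrr divr_gt0.
Qed.

Lemma ln_add_le x t : 0 < x -> 0 <= t -> ln (x + t) <= ln x + t / x.
Proof.
move=> x0 t0; have xt : 0 < x + t by rewrite ltr_wpDr.
rewrite (le_trans (ln_tangent xt x0))// lerD2l mulrDl divff ?gt_eqF//.
by rewrite addrAC subrr add0r.
Qed.

Definition xlnx x := x * ln x.

(** Multiply by [x] the tangent of [ln] at [1] and the tangent at [x] evaluated at [1]. This serves
    to bound [xlnx] of a bounded function. *)
Lemma xlnx_bounds x : 0 <= x -> x - 1 <= xlnx x <= x ^+ 2 - x.
Proof.
rewrite /xlnx le_eqVlt => /predU1P[<-|x0].
  by rewrite mul0r expr0n/= !sub0r oppr0 lexx andbT lerN10.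
have := ln_tangent x0 ltr01; rewrite ln1 add0r divr1 => lnx.
have := ln_tangent ltr01 x0; rewrite ln1 => lnx1.
apply/andP; split.
  have : x * 0 <= x * (ln x + (1 / x - 1)) by rewrite ler_pM2l.
  by rewrite mulr0 mulrDr mulrBr mulr1 mul1r mulfV ?gt_eqF//; lra.
have : x * ln x <= x * (x - 1) by rewrite ler_pM2l.
by rewrite mulrBr mulr1 -expr2.
Qed.

Lemma is_derive_xlnx1D x : -1 < x ->
  is_derive x 1 (fun t => xlnx (1 + t) - (t + t ^+ 2 / 2)) (ln (1 + x) - x).
Proof.
move=> x1; have x0 : 0 < 1 + x by lra.
have d1 : is_derive x 1 (fun t : R => 1 + t) 1.
  have := is_deriveD (is_derive_cst (1 : R) x 1) (is_derive_id x 1).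
  by rewrite add0r.
have dln : is_derive x 1 (fun t : R => ln (1 + t)) (1 + x)^-1.
  have := @is_derive1_comp _ (@ln R) (fun t : R => 1 + t) x _ _ (is_derive1_ln x0) d1.
  by rewrite mulr1.
have dM := is_deriveM d1 dln.
have dsq : is_derive x 1 (fun t : R => t + t ^+ 2 / 2) (1 + x).
  apply: is_derive_eq.
  by rewrite /GRing.scale/=; field.
apply: is_derive_eq (is_deriveB dM dsq) _.
by rewrite /GRing.scale/=; field; rewrite gt_eqF.
Qed.

(** The remainder [psi] vanishes at [0], and its derivative [ln (1 + s) - s] is at most [2 * t ^ 2]
    in absolute value for [|s| <= |t|]; conclude by the mean value theorem. *)
Lemma xlnx_taylor t : `|t| <= 2^-1 ->
  `|xlnx (1 + t) - (t + t ^+ 2 / 2)| <= 2 * `|t| ^+ 3.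
Proof.
move=> t2; pose psi (s : R) := xlnx (1 + s) - (s + s ^+ 2 / 2).
have dpsi (s : R) : `|s| <= `|t| -> is_derive s 1 psi (ln (1 + s) - s).
  move=> st; apply: is_derive_xlnx1D.
  by have := le_trans st t2; rewrite ler_norml; lra.
have dpsi_le (s : R) : `|s| <= `|t| -> `|ln (1 + s) - s| <= 2 * `|t| ^+ 2.
  move=> st; have := le_trans st t2; rewrite ler_norml => s2.
  have s0 : 0 < 1 + s by lra.
  (* Two tangents give [1 - 1 / (1 + s) <= ln (1 + s) <= s], with gap [s ^ 2 / (1 + s)]; the factor
     [2] comes from [1 + s >= 1 / 2]. *)
  have h1 := ln_tangent s0 ltr01; have h2 := ln_tangent ltr01 s0.
  rewrite ln1 add0r divr1 in h1; rewrite ln1 div1r in h2.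
  have s22 : s ^+ 2 <= `|t| ^+ 2 
    by rewrite -(real_normK (num_real s)) lerXn2r ?nnegrE.
  rewrite ler0_norm; last by lra.
  have e : (1 + s)^-1 - 1 + s = s ^+ 2 / (1 + s) by field; lra.
  have : s ^+ 2 / (1 + s) <= 2 * s ^+ 2.
    rewrite ler_pdivrMr// -subr_ge0.
    have -> : 2 * s ^+ 2 * (1 + s) - s ^+ 2 = s ^+ 2 * (1 + 2 * s) by ring.
    by rewrite mulr_ge0 ?sqr_ge0//; lra.
  by lra.
have psi0 : psi 0 = 0 by rewrite /psi /xlnx addr0 ln1; ring.
(* Stated for a general interval, so as to serve on [[0, t]] or [[t, 0]] according to the sign of
   [t]. *)
have mvt a b : a <= b -> (forall x, a <= x <= b -> `|x| <= `|t|) ->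
    `|psi b - psi a| <= 2 * `|t| ^+ 2 * (b - a).
  move=> ab abt.
  have [| |c cab ->] := @MVT_segment _ psi (fun s => ln (1 + s) - s) a b ab.
  - by move=> x; rewrite in_itv/= => /andP[ax xb]; apply/dpsi/abt; rewrite !ltW.
  - apply: derivable_within_continuous => x; rewrite in_itv/= => xab.
    by have [] := dpsi x (abt x xab).
  - rewrite normrM (ger0_norm (_ : 0 <= b - a)) ?subr_ge0// ler_wpM2r ?subr_ge0//.
    by apply/dpsi_le/abt; move: cab; rewrite in_itv.
rewrite -/(psi t) exprS mulrCA mulrC.
have [t0|t0] := leP 0 t.
  have := mvt 0 t t0; rewrite psi0 subr0 subr0 (ger0_norm t0); apply.
  by move=> x /andP[x0 xt]; rewrite ger0_norm.
have := mvt t 0 (ltW t0); rewrite psi0 !sub0r normrN (ltr0_norm t0); apply.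
by move=> x /andP[x0 xt]; rewrite ler0_norm// lerN2.
Qed.

(* With [p = sqrt t] and [q = sqrt s], this is [ln (q / p) <= q / p - 1]. *)
Lemma xlnx_sqrt_ge (s : R) t : 0 < s -> 0 <= t ->
  t * ln s + 2 * t - 2 * (Num.sqrt s * Num.sqrt t) <= xlnx t.
Proof.
move=> s0; rewrite le_eqVlt => /predU1P[<-|t0].
  by rewrite /xlnx sqrtr0 !(mul0r, mulr0) addr0 subr0.
have p0 : 0 < Num.sqrt t by rewrite sqrtr_gt0.
have q0 : 0 < Num.sqrt s by rewrite sqrtr_gt0.
have lnE (r : R) : 0 < r -> ln r = 2 * ln (Num.sqrt r).
  by move=> r0; rewrite -{1}(sqr_sqrtr (ltW r0)) lnXn ?sqrtr_gt0// mulr_natl.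
rewrite /xlnx (lnE s)// (lnE t)//.
have := ln_tangent q0 p0; have tE := sqr_sqrtr (ltW t0).
move: (Num.sqrt t) (Num.sqrt s) tE p0 q0 => p q <- p0 q0.
rewrite -(@ler_pM2l _ (p ^+ 2)) ?exprn_gt0// => h.
have e : p ^+ 2 * (ln p + (q / p - 1)) = p ^+ 2 * ln p + q * p - p ^+ 2.
  by field; rewrite gt_eqF.
by move: h; rewrite e; lra.
Qed.

End logarithm.

(** * Logarithm, inverse and square root of bounded measurable functions *)

Section bounded_measurable_logarithm.
Context d (T : measurableType d) (R : realType).
Implicit Types u : T -> R.

Lemma measurable_lne : measurable_fun setT (@lne R).
Proof.
have -> : @lne R = fun x => if (x <= 0)%E then -oo%E else
    if (x == +oo)%E then +oo%E else (ln (fine x))%:E.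
  apply/funext => -[r| |]; rewrite ?leNye//.
apply: measurable_fun_ifT => //.
  by apply: measurable_fun_lee.
apply: measurable_fun_ifT => //.
  exact: measurable_fun_eqe.
by apply/measurable_EFinP; apply: measurableT_comp => //; exact: measurable_ln.
Qed.

(** The conventions agree at [0]: [0 * -oo = 0] in the extended reals and [xlnx 0 = 0]. *)
Lemma mule_lne (r : R) : 0 <= r -> (r%:E * lne r%:E = (xlnx r)%:E)%E.
Proof.
rewrite /xlnx le_eqVlt => /predU1P[<-|r0]; first by rewrite mul0e mul0r.
by rewrite lne_EFin.
Qed.

Lemma bm_xlnx u : bounded_measurable u -> (forall x, 0 <= u x) ->
  bounded_measurable (fun x => xlnx (u x)).
Proof.
move=> [mu [M uM]] u0; split.
  by apply: measurable_funM => //; apply: measurableT_comp => //; exact: measurable_ln.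
exists (M ^+ 2 + 1) => x; have /andP[lb ub] := xlnx_bounds (u0 x).
have := uM x; rewrite ger0_norm// => uxM.
have u2 : u x ^+ 2 <= M ^+ 2 by rewrite lerXn2r// nnegrE// (le_trans _ uxM).
have := u0 x; have := sqr_ge0 M; rewrite ler_norml; lra.
Qed.

Lemma bm_addc u (c : R) : bounded_measurable u ->
  bounded_measurable (fun x => u x + c).
Proof. by move=> bu; apply: bmD => //; exact: bm_cst. Qed.

Lemma bm_ln u (c : R) : 0 < c -> bounded_measurable u -> (forall x, c <= u x) ->
  bounded_measurable (fun x => ln (u x)).
Proof.
move=> c0 [mu [M uM]] uc; split; first exact: measurableT_comp.
exists (`|ln c| + `|ln M|) => x.
have u0 : 0 < u x by exact: lt_le_trans (uc x).
have := uM x; rewrite gtr0_norm// => uxM.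
have lb : ln c <= ln (u x) by rewrite ler_ln.
have ub : ln (u x) <= ln M by rewrite ler_ln// posrE (lt_le_trans u0).
have := ler_norm (ln M); have := ler_norm (- ln c); rewrite normrN.
have := normr_ge0 (ln M); have := normr_ge0 (ln c).
rewrite ler_norml; lra.
Qed.

Lemma bm_inv u (c : R) : 0 < c -> bounded_measurable u -> (forall x, c <= u x) ->
  bounded_measurable (fun x => (u x)^-1).
Proof.
move=> c0 bu uc.
have u0 x : 0 < u x by exact: lt_le_trans (uc x).
(* Writing the inverse as [expR (- ln u)] yields measurability by composition. *)
have uE : (fun x => (u x)^-1) = expR \o (fun x => - ln (u x)).
  by apply/funext => x /=; rewrite expRN lnK ?posrE.
have [mln _] := bm_ln c0 bu uc.
split; first by rewrite uE; apply: measurableT_comp => //; exact: measurable_funN.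
exists c^-1 => x; rewrite gtr0_norm ?invr_gt0//.
by rewrite lef_pV2 ?posrE.
Qed.

Lemma bm_sqrt u : bounded_measurable u ->
  bounded_measurable (fun x => Num.sqrt (u x)).
Proof.
move=> [mu [M uM]]; split.
  apply: measurableT_comp => //; apply: continuous_measurable_fun.
  exact: sqrt_continuous.
exists (Num.sqrt M) => x; rewrite ger0_norm ?sqrtr_ge0// ler_wsqrtr//.
by rewrite (le_trans _ (uM x))// ler_norm.
Qed.

End bounded_measurable_logarithm.

(** * Conditional entropy, variance and covariance *)

Section conditional_functionals.
Context d (T : measurableType d) (R : realType) (P : probability T R).
Variable G : set (set T).
Hypothesis Gm : G `<=` measurable.
Local Notation S := (g_sigma_algebraType G).
Local Notation "<< u >>" := (Rintegral P setT u).
Implicit Types (f g : T -> R) (e u v : S -> R).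

Lemma mean_condexp f e : bounded_measurable f -> bounded_measurable e ->
  is_condexp P G (EFin \o f) (EFin \o e) -> << e >> = << f >>.
Proof.
move=> bf be [_ eE]; apply: EFin_inj.
rewrite -!EFin_Rintegral//; last exact: bm_sub.
by apply: eE; exact: (@measurableT _ S).
Qed.

(** Allows the arbitrary version chosen by [condexp] to be replaced by a bounded one under an
    integral. *)
Lemma condexp_ae f e : bounded_measurable e ->
  is_condexp P G (EFin \o f) (EFin \o e) ->
  {ae P, forall x, condexp P G (EFin \o f) x = (e x)%:E}.
Proof.
move=> be fe; apply: (condexp_uniq Gm); first by case: be.
  exact: bm_integrable (bm_sub Gm be).
have [_ eE] := fe; have [mc cE] := is_condexp_condexp fe.
by split => // A GA; rewrite cE// eE.
Qed.

Lemma measurable_condexp (h g : T -> \bar R) : is_condexp P G h g ->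
  measurable_fun setT (condexp P G h).
Proof. by move=> /is_condexp_condexp[mc _]; exact: (measurable_sub Gm mc). Qed.

(** With [a = 1] and [b = t], this turns a version for [g] into one for the perturbation
    [1 + t g]. *)
Lemma is_condexp_affine f e (a b : R) : bounded_measurable f ->
  bounded_measurable e -> is_condexp P G (EFin \o f) (EFin \o e) ->
  is_condexp P G (EFin \o (fun x => a + b * f x))
    (EFin \o (fun x => a + b * e x)).
Proof.
move=> bf be [_ eE]; split.
  by apply/measurable_EFinP; case: (bmD (bm_cst S a) (bmZ b be)).
move=> A GA; have mA := sub_measurable Gm GA.
have affE g : bounded_measurable g ->
    (\int[P]_(x in A) (a + b * g x)%:E =
     \int[P]_(x in A) a%:E + b%:E * \int[P]_(x in A) (g x)%:E)%E.
  move=> bg; rewrite -integralZl//; last exact: bm_integrable.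
  rewrite -integralD//.
    exact: (bm_integrable P mA (bm_cst T a)).
  exact: (bm_integrable P mA (bmZ b bg)).
by rewrite !affE//; [congr (_ + _ * _)%E; exact: eE|exact: bm_sub].
Qed.

(** The chosen versions are replaced by bounded ones, and the version [h] for [xlnx f] has the same
    mean as [xlnx f]. *)
Lemma integral_cond_ent f e : bounded_measurable f -> (forall x, 0 <= f x) ->
  bounded_measurable e -> (forall x, 0 <= e x) ->
  is_condexp P G (EFin \o f) (EFin \o e) ->
  (\int[P]_x (condexp P G (fun y => (f y * ln (f y))%:E) x -
     condexp P G (EFin \o f) x * lne (condexp P G (EFin \o f) x)) =
   (<< fun x => xlnx (f x) >> - << fun x => xlnx (e x) >>)%:E)%E.
Proof.
move=> bf f0 be e0 fe.
have bxf := bm_xlnx bf f0.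
have [_ [M xfM]] := bxf.
have xfM' x : - M <= xlnx (f x) <= M by rewrite -ler_norml.
have [h [bh _ fh]] := condexp_bounded_ex P Gm bxf xfM'.
have bhT := bm_sub Gm bh; have beT := bm_sub Gm be.
have bxe := bm_xlnx beT e0.
rewrite (@ae_eq_integral _ _ _ P setT
    (fun x => (h x - xlnx (e x))%:E)) //.
- by rewrite EFin_Rintegral ?meanB ?(mean_condexp bxf bh fh)//; exact: bmB.
- apply: emeasurable_funB; first exact: measurable_condexp fh.
  apply: emeasurable_funM; first exact: measurable_condexp fe.
  apply: measurableT_comp; first exact: measurable_lne.
  exact: measurable_condexp fe.
- by apply/measurable_EFinP; case: (bmB bhT bxe).
- apply: filterS (filterI (condexp_ae bh fh) (condexp_ae be fe)) => x [hx ex] _.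
  by rewrite hx ex mule_lne.
Qed.

Lemma integral_cond_var f e : bounded_measurable f -> bounded_measurable e ->
  is_condexp P G (EFin \o f) (EFin \o e) ->
  (\int[P]_x (condexp P G (fun y => (f y ^+ 2)%:E) x -
     condexp P G (EFin \o f) x ^+ 2) =
   (<< fun x => f x ^+ 2 >> - << fun x => e x ^+ 2 >>)%:E)%E.
Proof.
move=> bf be fe.
have bf2 := bmX bf.
have [_ [M f2M]] := bf2.
have f2M' x : - M <= f x ^+ 2 <= M by rewrite -ler_norml.
have [h [bh _ fh]] := condexp_bounded_ex P Gm bf2 f2M'.
have bhT := bm_sub Gm bh; have beT := bm_sub Gm be.
have be2 := bmX beT.
rewrite (@ae_eq_integral _ _ _ P setT (fun x => (h x - e x ^+ 2)%:E)) //.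
- by rewrite EFin_Rintegral ?meanB ?(mean_condexp bf2 bh fh)//; exact: bmB.
- apply: emeasurable_funB; first exact: measurable_condexp fh.
  by under eq_fun do rewrite expe2; apply: emeasurable_funM; exact: measurable_condexp fe.
- by apply/measurable_EFinP; case: (bmB bhT be2).
- apply: filterS (filterI (condexp_ae bh fh) (condexp_ae be fe)) => x [hx ex] _.
  by rewrite hx ex EFinB EFin_expe.
Qed.

(** A raised tangent of [ln] at [e + 1 / (n + 1)] dominates [ln f], and its linear term integrates
    to zero over sets of the coarser sigma-algebra. Then [n] tends to infinity. The shift keeps the
    logarithm bounded where [e] vanishes. *)
Lemma cond_jensen_ln f e (L : T -> \bar R) :
  bounded_measurable f -> (forall x, 0 <= f x) ->
  bounded_measurable e -> (forall x, 0 <= e x) ->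
  is_condexp P G (EFin \o f) (EFin \o e) ->
  is_condexp P G (fun x => lne (f x)%:E) L ->
  {ae P, forall x, 0 < e x -> (L x <= (ln (e x))%:E)%E}.
Proof.
move=> bf f0 be e0 fe [mL LE].
pose ed n (x : S) := e x + n.+1%:R^-1.
have n0 n : 0 < n.+1%:R^-1 :> R by rewrite invr_gt0.
have ned n x : n.+1%:R^-1 <= ed n x by rewrite lerDr.
have ed0 n x : 0 < ed n x by rewrite (lt_le_trans (n0 n)).
have bed n : bounded_measurable (ed n) by exact: bm_addc.
have bln n := bm_ln (n0 n) (bed n) (ned n).
have bV n := bm_inv (n0 n) (bed n) (ned n).
have L_le n : {ae P, forall x, (L x <= (ln (ed n x))%:E)%E}.
  apply: (le_condexp Gm) => //; first by case: (bln n).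
    exact: bm_integrable (bm_sub Gm (bln n)).
  move=> A GA; have mA := sub_measurable Gm GA; rewrite LE//.
  have blnT := bm_sub Gm (bln n); have bVT := bm_sub Gm (bV n).
  have beT := bm_sub Gm be.
  (* The tangent at [ed n] raised by [(ed n - e) / ed n], so that its linear term is centred at [e]
     and has zero conditional mean. *)
  pose w (x : T) := ln (ed n x) + (f x - e x) * (ed n x)^-1.
  have bw : bounded_measurable w by apply: bmD => //; apply: bmM => //; exact: bmB.
  apply: (@le_trans _ _ (\int[P]_(x in A) (w x)%:E)%E).
    apply: ae_le_integral => //.
    - apply: measurable_funTS; apply: measurableT_comp; first exact: measurable_lne.
      by apply/measurable_EFinP; case: bf.
    - by apply: measurable_funTS; apply/measurable_EFinP; case: bw.
    apply: aeW => x _; have := f0 x; rewrite le_eqVlt => /predU1P[<-|fx0].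
      by rewrite le0_lneNy// leNye.
    rewrite lne_EFin// lee_fin /w (le_trans (ln_tangent fx0 (ed0 n x)))// lerD2l.
    rewrite -subr_ge0.
    have divE (p q r : R) : 0 < q + r ->
        (p - q) * (q + r)^-1 - (p / (q + r) - 1) = r / (q + r).
      by move=> qr; field; rewrite gt_eqF.
    rewrite divE; last exact: ed0.
    by apply: divr_ge0; apply: ltW; [exact: n0|exact: ed0].
  rewrite !integral_mean_indic// lee_fin.
  have bA := bm_indic R (GA : measurable (A : set S)).
  have bAT := bm_indic R mA.
  pose k (x : S) := (ed n x)^-1 * \1_A x.
  have bk : bounded_measurable k by exact: bmM.
  have bkT := bm_sub Gm bk.
  under eq_Rintegral do rewrite /w mulrDl mulrBl mulrBl -!mulrA -/(k _).
  rewrite meanD; [|exact: bmM|by apply: bmB; exact: bmM].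
  rewrite meanB; [|exact: bmM..].
  by rewrite (mean_condexpM Gm bf be bk fe) subrr addr0.
apply: filterS (ae_foralln L_le) => x Lx ex0.
apply/lee_addgt0Pr => r r0.
(* With [1 / (n + 1) < e x * r], the shift raises the logarithm by at most [r]. *)
have [n] := ltr_add_invr (mulr_gt0 ex0 r0); rewrite add0r => nr.
rewrite (le_trans (Lx n))// -EFinD lee_fin (le_trans (ln_add_le ex0 _))// lerD2l.
by rewrite ler_pdivrMr// mulrC ltW.
Qed.

(** Since [f lne f = f ln f] everywhere, both sides share their first term; conditional Jensen
    multiplied by [e] compares the second ones. *)
Lemma cond_ent_le_cov f : bounded_measurable f -> (forall x, 0 <= f x) ->
  (\int[P]_x (condexp P G (fun y => (f y * ln (f y))%:E) x -
     condexp P G (EFin \o f) x * lne (condexp P G (EFin \o f) x)) <=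
   \int[P]_x (condexp P G ((EFin \o f) \* (fun y => lne (f y)%:E)) x -
     condexp P G (EFin \o f) x * condexp P G (fun y => lne (f y)%:E) x))%E.
Proof.
move=> bf f0.
have -> : ((EFin \o f) \* (fun y => lne (f y)%:E))%E = (fun y => (f y * ln (f y))%:E).
  by apply/funext => x; exact: mule_lne.
have [_ [M fM]] := bf.
have fM' x : 0 <= f x <= M by rewrite f0/= (le_trans _ (fM x))// ler_norm.
have [e [be e0M fe]] := condexp_bounded_ex P Gm bf fM'.
have e0 x : 0 <= e x by have /andP[] := e0M x.
have mf : measurable_fun setT (EFin \o f) by apply/measurable_EFinP; case: bf.
have bxf := bm_xlnx bf f0.
have [_ [K xfK]] := bxf.
have mB : measurable_fun setT (condexp P G (fun y => (f y * ln (f y))%:E)).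
  apply: (@measurable_condexp _ (condexp P G (fun y => (f y * ln (f y))%:E))).
  apply: (@condexpP _ _ _ _ _ Gm _ K).
    by apply/measurable_EFinP; case: bxf.
  by move=> x; rewrite lee_fin (le_trans _ (xfK x))// ler_norm.
have lnfP : is_condexp P G (fun y => lne (f y)%:E)
    (condexp P G (fun y => lne (f y)%:E)).
  (* The logarithm of [f] may be [-oo] but is at most [M], because [ln x < x]. *)
  apply: (@condexpP _ _ _ _ _ Gm _ M).
    by apply: measurableT_comp mf; exact: measurable_lne.
  move=> x; have := f0 x; rewrite le_eqVlt => /predU1P[<-|fx0].
    by rewrite le0_lneNy// leNye.
  rewrite lne_EFin// lee_fin (le_trans (ltW (ln_sublinear fx0)))//.
  by have /andP[] := fM' x.
have mc := measurable_condexp fe.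
apply: ae_le_integral => //.
- apply: emeasurable_funB => //; apply: emeasurable_funM => //.
  by apply: measurableT_comp mc; exact: measurable_lne.
- apply: emeasurable_funB => //; apply: emeasurable_funM => //.
  exact: measurable_condexp lnfP.
have jensen := cond_jensen_ln bf f0 be e0 fe lnfP.
have aeF := ae_filter_ringOfSetsType P.
apply: filterS (filterI jensen (condexp_ae be fe)) => x [Lx ->] _.
(* Where [e] vanishes both products are [0], whatever the conditional expectation of [ln f]. *)
apply: leeB => //; have := e0 x; rewrite le_eqVlt => /predU1P[<-|ex0].
  by rewrite !mul0e.
by apply: lee_wpmul2l; rewrite ?lee_fin// lne_EFin// Lx.
Qed.

(* With [a = E[f | G]], [b = E[sqrt f | G]] and [v = sqrt (a + t)], integrate
   [xlnx_sqrt_ge (a + t) f] and complete the square: [a + t - 2 b v + b ^ 2] is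
   [(v - b) ^ 2]. The shift [t] avoids [ln 0]. *)
Lemma cond_var_sqrt_le_ent f (a b : S -> R) :
  bounded_measurable f -> (forall x, 0 <= f x) ->
  bounded_measurable a -> (forall x, 0 <= a x) ->
  is_condexp P G (EFin \o f) (EFin \o a) ->
  bounded_measurable b ->
  is_condexp P G (EFin \o (fun x => Num.sqrt (f x))) (EFin \o b) ->
  << f >> - << fun x => b x ^+ 2 >> <=
  << fun x => xlnx (f x) >> - << fun x => xlnx (a x) >>.
Proof.
move=> bf f0 ba a0 fa bb fb.
apply/ler_addgt0Pr => t t0.
pose at_ (x : S) := a x + t.
have tat x : t <= at_ x by rewrite lerDr.
have at0 x : 0 < at_ x by rewrite (lt_le_trans t0).
have bat : bounded_measurable at_ by exact: bm_addc.
have bu := bm_ln t0 bat tat; have bv := bm_sqrt bat.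
have bs := bm_sqrt bf; have bxf := bm_xlnx bf f0.
have baT := bm_sub Gm ba; have bbT := bm_sub Gm bb.
have buT := bm_sub Gm bu; have bvT := bm_sub Gm bv.
have bxa := bm_xlnx baT a0; have bb2 := bmX bbT.
have h1 : << fun x => f x * ln (at_ x) >> + 2 * << f >> -
    2 * << fun x => Num.sqrt (f x) * Num.sqrt (at_ x) >> <=
    << fun x => xlnx (f x) >>.
  rewrite -!meanZ//; last exact: bmM.
  have b1 : bounded_measurable (fun x : T => f x * ln (at_ x)) by exact: bmM.
  have b2 := bmZ 2 bf; have b3 := bmZ 2 (bmM bs bvT).
  rewrite -meanD// -meanB//; last exact: bmD.
  apply: le_mean => //; first by apply: bmB => //; exact: bmD.
  by move=> x; rewrite [X in _ - 2 * X]mulrC; exact: xlnx_sqrt_ge.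
have h2 : << fun x => xlnx (a x) >> - << fun x => a x * ln (at_ x) >> <= 0.
  rewrite -meanB//; last exact: bmM.
  rewrite -(mean_cst P 0); apply: le_mean; [by apply: bmB => //; exact: bmM|exact: bm_cst|].
  move=> x; rewrite subr_le0 /xlnx; have := a0 x; rewrite le_eqVlt => /predU1P[<-|ax0].
    by rewrite !mul0r.
  by rewrite ler_pM2l// ler_ln ?posrE// lerDl ltW.
have h3 : 0 <= << a >> + t - 2 * << fun x => b x * Num.sqrt (at_ x) >> +
    << fun x => b x ^+ 2 >>.
  have b3 := bmZ 2 (bmM bbT bvT); have bat' := bm_sub Gm bat.
  rewrite -{1}(mean_cst P t) -meanD//; last exact: bm_cst.
  rewrite -meanZ//; last exact: bmM.
  rewrite -meanB// -meanD//; last exact: bmB.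
  rewrite -(mean_cst P 0); apply: le_mean; [exact: bm_cst|by apply: bmD => //; exact: bmB|].
  move=> x; have := sqr_sqrtr (ltW (at0 x)); rewrite /at_ => {1}<-.
  have -> (p q : R) : p ^+ 2 - 2 * (q * p) + q ^+ 2 = (p - q) ^+ 2 by ring.
  exact: sqr_ge0.
(* Against functions of [a + t], conditioning replaces [f] by [a] and [sqrt f] by [b]; adding [h1],
   [h2] and [h3] gives the claim with excess [t]. *)
rewrite (mean_condexpM Gm bf ba bu fa) (mean_condexpM Gm bs bb bv fb) in h1.
rewrite -(mean_condexp bf ba fa) in h1 *.
by move: h1 h2 h3; lra.
Qed.

End conditional_functionals.

(** * The implications *)

(** Dividing by [t ^ 2 / 2] leaves an error [2 * K * t], which vanishes with [t]. *)
Lemma le_of_second_order (R : realFieldType) (V W K r : R) : 0 < r -> 0 <= K ->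
  (forall t, 0 < t <= r -> t ^+ 2 / 2 * V <= t ^+ 2 / 2 * W + t ^+ 3 * K) ->
  V <= W.
Proof.
move=> r0 K0 VW; apply/ler_addgt0Pr => s s0.
(* Makes [2 * K * t] at most [s]; the added [1] keeps the denominator positive when [K = 0]. *)
pose t := Num.min r (s / (2 * K + 1)).
have K1 : 0 < 2 * K + 1 by rewrite ltr_wpDl// mulr_ge0.
have t0 : 0 < t by rewrite lt_min r0 divr_gt0.
have tr : t <= r by rewrite ge_min lexx.
have ts : t * (2 * K + 1) <= s by rewrite -ler_pdivlMr// ge_min lexx orbT.
have t2 : 0 < t ^+ 2 / 2 by rewrite divr_gt0// exprn_gt0.
rewrite -(ler_pM2l t2); apply: le_trans (VW t _) _; first by rewrite t0.
rewrite mulrDr lerD2l.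
have -> : t ^+ 3 * K = t ^+ 2 / 2 * (t * (2 * K)) by field.
by rewrite ler_pM2l// (le_trans _ ts)// mulrDr mulr1 lerDl ltW.
Qed.

Lemma bounded_fun_bm d (T : measurableType d) (R : realType) (f : T -> R) :
  measurable_fun setT f -> bounded_fun f -> bounded_measurable f.
Proof.
(* [bounded_fun] gives the bound only for reals strictly above [M], hence [M + 1]. *)
move=> mf [M [_ fM]]; split => //; exists (M + 1) => x.
by apply: (fM (M + 1)) => //; rewrite ltrDl.
Qed.

(** * Second-order expansion of the mean of [xlnx] *)

Section mean_xlnx.
Context d (T : measurableType d) (R : realType) (P : probability T R).
Local Notation "<< u >>" := (Rintegral P setT u).

Lemma xlnx_scale_taylor (M t y : R) : 0 < t -> t * M <= 2^-1 -> `|y| <= M ->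
  `|xlnx (1 + t * y) - (t * y + t ^+ 2 / 2 * y ^+ 2)| <= t ^+ 3 * (2 * M ^+ 3).
Proof.
move=> t0 tM yM; have ty : `|t * y| <= t * M by rewrite normrM gtr0_norm// ler_pM2l.
have -> : t ^+ 2 / 2 * y ^+ 2 = (t * y) ^+ 2 / 2 by field.
rewrite (le_trans (xlnx_taylor (le_trans ty tM)))//.
have -> : t ^+ 3 * (2 * M ^+ 3) = 2 * (t * M) ^+ 3 by ring.
by rewrite ler_pM2l// lerXn2r// nnegrE (le_trans _ ty).
Qed.

Lemma mean_xlnx_taylor (u : T -> R) (M t : R) : bounded_measurable u ->
  (forall x, `|u x| <= M) -> 0 < t -> t * M <= 2^-1 ->
  `|<< fun x => xlnx (1 + t * u x) >> -
    (t * << u >> + t ^+ 2 / 2 * << fun x => u x ^+ 2 >>)| <=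
  t ^+ 3 * (2 * M ^+ 3).
Proof.
move=> bu uM t0 tM; have bu2 := bmX bu.
have b1 := bmZ t bu; have b2 := bmZ (t ^+ 2 / 2) bu2.
have b3 : bounded_measurable (fun x => xlnx (1 + t * u x)).
  apply: bm_xlnx; first by apply: bmD => //; exact: bm_cst.
  move=> x; have : `|t * u x| <= 2^-1.
    by rewrite (le_trans _ tM)// normrM gtr0_norm// ler_pM2l.
  by rewrite ler_norml; lra.
rewrite -!meanZ// -meanD// -meanB//; last exact: bmD.
rewrite ler_norml; apply: mean_itv; first by apply: bmB => //; exact: bmD.
by move=> x; rewrite -ler_norml; exact: xlnx_scale_taylor.
Qed.

End mean_xlnx.

Section implications.
Context (R : realType) (N : nat) (d : 'I_N -> measure_display)
  (Omega : forall i : 'I_N, measurableType (d i)).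
Variable mu : probability (product_space Omega) R.
Local Notation "<< u >>" := (Rintegral mu setT u).
Local Notation coord k := (cylinders Omega (~` [set k])).
Local Notation X := (product_space Omega).

Lemma coord_measurable (k : 'I_N) : (coord k : set (set X)) `<=` measurable.
Proof.
by move=> A [i _ iA]; apply: sub_sigma_algebra; exists i.
Qed.

Lemma Ent_fin (f : X -> R) : bounded_measurable f -> (forall x, 0 <= f x) ->
  Ent mu f = (<< fun x => xlnx (f x) >> - xlnx << f >>)%:E.
Proof.
move=> bf f0; rewrite /Ent unlock EFin_Rintegral; last exact: bm_xlnx.
rewrite EFin_Rintegral// mule_lne// -(mean_cst mu 0).
by apply: le_mean => //; exact: bm_cst.
Qed.

Lemma Var_fin (g : X -> R) : bounded_measurable g ->
  Var mu g = (<< fun x => g x ^+ 2 >> - << g >> ^+ 2)%:E.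
Proof.
by move=> bg; rewrite /Var unlock !EFin_Rintegral//; exact: bmX.
Qed.

Lemma AT_MLS (C : R) : 0 < C -> AT mu C -> MLS mu C.
Proof.
move=> C0 at_ f mf bndf f0; apply: le_trans (at_ f mf bndf f0) _.
apply: lee_wpmul2l; first by rewrite lee_fin ltW.
apply: lee_sum => k _; apply: cond_ent_le_cov => //; first exact: coord_measurable.
exact: bounded_fun_bm.
Qed.

Lemma LS_AT (C : R) : 0 < C -> LS mu C -> AT mu C.
Proof.
move=> C0 ls f mf bndf f0; apply: le_trans (ls f mf bndf f0) _.
apply: lee_wpmul2l; first by rewrite lee_fin ltW.
apply: lee_sum => k _.
have Gm := @coord_measurable k.
have bf := bounded_fun_bm mf bndf; have [_ [M fM]] := bf.
have bs := bm_sqrt bf; have [_ [K sK]] := bs.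
have f0M x : 0 <= f x <= M by rewrite f0 (le_trans _ (fM x))// ler_norm.
have sK' x : - K <= Num.sqrt (f x) <= K by rewrite -ler_norml.
have [a [ba a0M fa]] := condexp_bounded_ex mu Gm bf f0M.
have [b [bb _ fb]] := condexp_bounded_ex mu Gm bs sK'.
have a0 x : 0 <= a x by have /andP[] := a0M x.
rewrite [leLHS](integral_cond_var Gm bs bb fb).
rewrite [leRHS](integral_cond_ent Gm bf f0 ba a0 fa) lee_fin.
rewrite (_ : << fun x => Num.sqrt (f x) ^+ 2 >> = << f >>).
  exact: cond_var_sqrt_le_ent fb.
by apply: eq_Rintegral => x _; rewrite sqr_sqrtr.
Qed.

(** The linear terms of the expansions cancel because [g] and each of its conditional expectations
    have the same mean; variances times [t ^ 2 / 2] and cubic errors remain. *)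
Lemma AT_Poincare (C : R) : 0 < C -> AT mu C -> Poincare mu C.
Proof.
move=> C0 at_ g mg bndg; have bg := bounded_fun_bm mg bndg.
(* A positive bound is taken because [t] will range up to [1 / (2 * M)]. *)
have [M [M0 gM]] : exists M, 0 < M /\ forall x, `|g x| <= M.
  have [_ [K gK]] := bg; exists (`|K| + 1); split; first by rewrite ltr_wpDl.
  by move=> x; rewrite (le_trans (gK x))// (le_trans (ler_norm _))// lerDl.
have gM' x : - M <= g x <= M by rewrite -ler_norml.
(* Typing [y] on [X] gives it the same type for every [k], as [choice] requires. *)
have ex k : exists y : X -> R,
    [/\ bounded_measurable (y : g_sigma_algebraType (coord k) -> R),
      forall x, - M <= y x <= M & is_condexp mu (coord k) (EFin \o g) (EFin \o y)].
  exact (condexp_bounded_ex mu (@coord_measurable k) bg gM').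
have [e eP] := choice ex.
have be k : bounded_measurable (e k : g_sigma_algebraType (coord k) -> R).
  by case: (eP k).
have beX k := bm_sub (@coord_measurable k) (be k).
have eM k x : `|e k x| <= M by case: (eP k) => _ /(_ x); rewrite -ler_norml.
have ge k : is_condexp mu (coord k) (EFin \o g) (EFin \o e k) by case: (eP k).
have mean_e k : << e k >> = << g >> :=
  mean_condexp (@coord_measurable k) bg (be k) (ge k).
rewrite (Var_fin bg).
under eq_bigr do
  rewrite /Var_ (integral_cond_var (@coord_measurable _) bg (be _) (ge _)).
rewrite sumEFin -EFinM lee_fin.
(* The error of one expansion is at most [t ^ 3 * D]. Each entropy is a difference of two, whence
   [2 * D] for the left side and for each [k]. *)
pose D := 2 * M ^+ 3.
have D0 : 0 < 2 * D by rewrite !mulr_gt0// exprn_gt0.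
apply: (@le_of_second_order _ _ _ (2 * D + C * (\sum_(k < N) 2 * D)) (2 * M)^-1).
- by rewrite invr_gt0 mulr_gt0.
- apply: addr_ge0; first exact: ltW.
  by apply: mulr_ge0; [exact: ltW|apply: sumr_ge0 => k _; exact: ltW].
move=> t /andP[t0 tM].
have {}tM : t * M <= 2^-1.
  by rewrite -ler_pdivlMr// -invfM.
(* Nonnegativity is needed both to apply [AT] to [1 + t g] and for the conditional expectations
   [1 + t e_k]. *)
have small y : `|y| <= M -> 0 <= 1 + t * y.
  move=> yM; have : `|t * y| <= 2^-1.
    by rewrite (le_trans _ tM)// normrM gtr0_norm// ler_pM2l.
  by rewrite ler_norml; lra.
have bf : bounded_measurable (fun x => 1 + t * g x).
  by apply: bmD; [exact: bm_cst|exact: bmZ].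
have f0 x : 0 <= 1 + t * g x by exact: small.
have bndf : bounded_fun (fun x => 1 + t * g x).
  have [_ [K fK]] := bf; exists K; split; first exact: num_real.
  by move=> r Kr x _; apply: le_trans (fK x) _; exact: ltW.
have := at_ _ bf.1 bndf f0; rewrite Ent_fin//.
under eq_bigr do rewrite /Ent_ (integral_cond_ent (@coord_measurable _) bf f0
  (bmD (bm_cst _ 1) (bmZ t (be _))) (fun x => small _ (eM _ x))
  (is_condexp_affine (@coord_measurable _) 1 t bg (be _) (ge _))).
rewrite sumEFin -EFinM lee_fin => at_f.
have mg' : << fun x => 1 + t * g x >> = 1 + t * << g >>.
  by rewrite meanD ?meanZ ?mean_cst//; [exact: bm_cst|exact: bmZ].
have mgM : `|<< g >>| <= M by rewrite ler_norml; exact: mean_itv.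
have Tg := mean_xlnx_taylor mu bg gM t0 tM.
have Tm := xlnx_scale_taylor t0 tM mgM.
have Te k := mean_xlnx_taylor mu (beX k) (eM k) t0 tM.
rewrite mg' in at_f.
have sum_le : C * (\sum_(k < N) (<< fun x => xlnx (1 + t * g x) >> -
      << fun x => xlnx (1 + t * e k x) >>)) <=
    C * (\sum_(k < N) (t ^+ 2 / 2 * (<< fun x => g x ^+ 2 >> -
      << fun x => e k x ^+ 2 >>) + t ^+ 3 * (2 * D))).
  rewrite ler_pM2l//; apply: ler_sum => k _.
  have := Te k; rewrite mean_e; move: Tg; rewrite -/D !ler_norml; lra.
rewrite [leRHS](_ : _ = C * (t ^+ 2 / 2 * (\sum_(k < N)
      (<< fun x => g x ^+ 2 >> - << fun x => e k x ^+ 2 >>)) +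
    t ^+ 3 * \sum_(k < N) 2 * D)) in sum_le; last first.
  by rewrite big_split/= !mulr_sumr.
move: Tg Tm at_f sum_le; rewrite -/D !ler_norml; lra.
Qed.

End implications.

Theorem proposition1p1 (R : realType) (N : nat) (d : 'I_N -> measure_display)
    (Omega : forall i : 'I_N, measurableType (d i))
    (mu : probability (product_space Omega) R) (C : R) (hC : 0 < C) :
  (AT mu C -> Poincare mu C) /\ (LS mu C -> AT mu C) /\ (AT mu C -> MLS mu C).
Proof.
by split; [exact: AT_Poincare|split; [exact: LS_AT|exact: AT_MLS]].
Qed.
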